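(* For any integer $n>1$ there exists an $H_0\le -1$ such that for any $H<H_0$ there exists an embedding with constant mean curvature $H$ from $H^{n-1}\times S^1$ to $H^{n+1}$.
   Context: For each $k\ge 1$, $H^{k}=\{x\in\mathbb{R}^{k+1}: x_1^2+\dots+x_{k}^2-x_{k+1}^2=-1\}$ is the model of hyperbolic space in $\mathbb{R}^{k+1}$ endowed with the inner product $\langle v,w\rangle=v_1w_1+\dots+v_kw_k-v_{k+1}w_{k+1}$. Mean curvature is the average of the $n$ principal curvatures, with respect to a suitable unit normal. *)

(* Defs.v *)
From HB Require Import structures.
From mathcomp Require Import all_boot all_order all_algebra.
From mathcomp Require Import all_classical all_reals all_analysis.

Set Implicit Arguments.
Unset Strict Implicit.
Unset Printing Implicit Defensive.

Import Order.TTheory GRing.Theory Num.Theory.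
Import numFieldNormedType.Exports.

Local Open Scope classical_set_scope.
Local Open Scope ring_scope.

Section Smooth.
Context {R : realType}.

(* Meant for open U: f is C^k on U iff it is differentiable there and all its
   directional derivatives are C^(k-1). *)
Fixpoint Ck {V W : normedModType R} (k : nat) (U : set V) (f : V -> W) : Prop :=
  match k with
  | 0 => forall x, U x -> {for x, continuous f}
  | k'.+1 => (forall x, U x -> differentiable f x) /\
             (forall v : V, Ck k' U ('D_v f))
  end.

Definition smooth_near {V W : normedModType R} (x : V) (f : V -> W) : Prop :=
  exists2 U : set V, open_nbhs x U & forall k, Ck k U f.

(* Maps on a submanifold M of V are total functions V -> W whose values outside
   M are irrelevant; they are smooth when they locally agree on M with smooth
   maps of the ambient space. *)
Definition smooth_map {V W : normedModType R} (M : set V) (f : V -> W) : Prop :=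
  forall p, M p -> exists2 F : V -> W,
    smooth_near p F & \forall q \near p, M q -> F q = f q.

Definition curves_at {V : normedModType R} (M : set V) (p v : V) : set (R -> V) :=
  [set c | [/\ @smooth_near R^o V 0 c, (\forall t \near (0 : R), M (c t)),
               c 0 = p & c^`()%classic 0 = v]].

Definition tangent_space {V : normedModType R} (M : set V) (p : V) : set V :=
  [set v | curves_at M p v !=set0].

(* df_p(v) = (f o c)'(0) for any curve c in M through p with velocity v; for
   smooth f this does not depend on c. The default 0 is only taken when v is
   not tangent to M at p. *)
Definition tdiff {V W : normedModType R} (M : set V) (f : V -> W) (p v : V) : W :=
  xget 0 [set (f \o c)^`()%classic 0 | c in curves_at M p v].

Definition immersion {V W : normedModType R} (M : set V) (f : V -> W) : Prop :=
  smooth_map M f /\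
  forall p v, M p -> tangent_space M p v -> tdiff M f p v = 0 -> v = 0.

Definition embedding {V W : normedModType R} (M : set V) (N : set W)
    (f : V -> W) : Prop :=
  [/\ f @` M `<=` N, immersion M f &
      exists2 g : W -> V, (forall x, M x -> g (f x) = x) &
                          {within f @` M, continuous g}].

Definition basis_of_set {V : normedModType R} (n : nat) (E : set V)
    (e : 'I_n -> V) : Prop :=
  (forall a : 'I_n -> R, \sum_i a i *: e i = 0 -> forall i, a i = 0) /\
  (forall v, E v <-> exists a : 'I_n -> R, v = \sum_i a i *: e i).

End Smooth.

Section Hyperbolic.
Context {R : realType}.

(* Coordinates 0, ..., k-1 carry the sign +, the last one, k, the sign -. *)
Definition mink {k : nat} (v w : 'rV[R]_k.+1) : R :=
  \sum_(i < k) v 0 (widen_ord (leqnSn k) i) * w 0 (widen_ord (leqnSn k) i)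
  - v 0 ord_max * w 0 ord_max.

(* The whole quadric <x, x> = -1: the sign of the last coordinate is not
   restricted. The one-sheet and two-sheet readings of the existence of an
   embedding H^(n-1) x S^1 -> H^(n+1) of constant mean curvature H are
   equivalent, through x |-> -x. *)
Definition hyperbolic_space (k : nat) : set 'rV[R]_k.+1 :=
  [set x | mink x x = -1].

Definition circle : set 'rV[R]_2 := [set u | u 0 0 ^+ 2 + u 0 1 ^+ 2 = 1].

Section Hypersurface.
Context {V : normedModType R} {n : nat}.
Variables (M : set V) (f : V -> 'rV[R]_n.+2).
Implicit Types (nu : V -> 'rV[R]_n.+2) (p v : V).

(* f : M -> H^(n+1) is an immersion of an n-dimensional M. The tangent space of
   H^(n+1) at x is the orthogonal of x, and mink is positive definite on it. *)
Definition unit_normal nu : Prop :=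
  smooth_map M nu /\
  forall p, M p ->
    [/\ mink (nu p) (nu p) = 1, mink (nu p) (f p) = 0 &
        forall v, tangent_space M p v -> mink (nu p) (tdiff M f p v) = 0].

(* Levi-Civita connection of H^(n+1) along f: the projection of the ambient
   derivative onto the orthogonal of f p, where <f p, f p> = -1. *)
Definition covariant_deriv nu p v : 'rV[R]_n.+2 :=
  let d := tdiff M nu p v in d + mink d (f p) *: f p.

Definition shape_operator nu p (A : V -> V) : Prop :=
  forall v, tangent_space M p v ->
    tangent_space M p (A v) /\
    tdiff M f p (A v) = - covariant_deriv nu p v.

(* The eigenvalues of the shape operator, repeated with multiplicity. *)
Definition principal_curvatures nu p (kappa : 'I_n -> R) : Prop :=
  exists2 A : V -> V, shape_operator nu p A &
  exists2 e : 'I_n -> V, basis_of_set (tangent_space M p) e &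
    forall i, A (e i) = kappa i *: e i.

Definition mean_curvature nu p (H : R) : Prop :=
  exists2 kappa : 'I_n -> R, principal_curvatures nu p kappa &
    H = (\sum_i kappa i) / n%:R.

Definition constant_mean_curvature (H : R) : Prop :=
  exists2 nu : V -> 'rV[R]_n.+2, unit_normal nu &
    forall p, M p -> mean_curvature nu p H.

End Hypersurface.
End Hyperbolic.

Arguments hyperbolic_space {R} k _.

(* Main.v *)
Require Import Defs.
From HB Require Import structures.
From mathcomp Require Import all_boot all_order all_algebra.
From mathcomp Require Import all_classical all_reals all_analysis.
From mathcomp Require Import ring lra.
Import Order.TTheory GRing.Theory Num.Theory.
Import numFieldNormedType.Exports.
Local Open Scope classical_set_scope.
Local Open Scope ring_scope.

Set Implicit Arguments.
Unset Strict Implicit.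
Unset Printing Implicit Defensive.

(** The embeddings are the equidistant tubes around a totally geodesic H^(n-1)
in H^(n+1). The ambient space is split as R^2 + R^n, with the circle in R^2 and
H^(n-1) in R^n, and the tube is [tube a b : (x, u) |-> (a u, b x)] with b^2 -
a^2 = 1: it lands in H^(n+1) because |u|^2 = 1 and <x, x> = -1. The map [tube b
a], with the two coefficients exchanged, is a unit normal field along it. Both
maps are restrictions of linear maps, so they are their own differentials
([tdiff_linear]), and the Weingarten equation is solved by the map that
multiplies vectors tangent to the circle by - b / a and vectors tangent to
H^(n-1) by - a / b ([tube_shape_operator]). Hence the mean curvature is - (z +
(n - 1) / z) / n with z = b / a > 1 ([tube_mean_curvature]). Given H < -1, the
quadratic equation z^2 - n |H| z + (n - 1) = 0 has a root z > 1
([radius_ratio]), so that H_0 = -1 works.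

All this rests on the tangent space of H^(n-1) x S^1, which consists at (x, u)
of the pairs (w, v) with w orthogonal to x and v orthogonal to u
([tangent_space_quadricM]). Differentiating the two equations gives one
inclusion. The other needs a smooth curve with each prescribed velocity: a
plane section of a quadric through a point is a conic, which its chords through
a fixed point parametrize rationally ([conic_curve]); the smoothness of this
rational curve comes from the closure of smooth functions of one variable under
sums, products and inverses. *)

(** * Smooth functions of one variable *)

Section SmoothCalculus.
Context {R : realType}.
Implicit Types V W : normedModType R.

Lemma Ck_cst V W k (U : set V) (w : W) : Ck k U (cst w).
Proof.
elim: k w => [|k IHk] w /=; first by move=> x _; exact: cst_continuous.
split=> [x _|v]; first exact: differentiable_cst.
by rewrite (_ : 'D_v (cst w) = cst 0) //; apply/funext=> x; rewrite derive_cst.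
Qed.

Lemma smooth_near_linear V W (L : {linear V -> W}) (x : V) :
  continuous L -> smooth_near x L.
Proof.
move=> cL; exists setT => [|k]; first by split=> //; exact: openT.
case: k => [|k] /=; first by move=> y _; exact: cL.
split=> [y _|v]; first exact: linear_differentiable.
rewrite (_ : 'D_v L = cst (L v)); first exact: Ck_cst.
by apply/funext=> y; rewrite deriveE ?diff_lin//; exact: linear_differentiable.
Qed.

Lemma smooth_near_differentiable V W (x : V) (f : V -> W) :
  smooth_near x f -> differentiable f x.
Proof. by move=> [U [_ Ux] /(_ 1%N) [/(_ x Ux)]]. Qed.

Lemma Ck_sub V W k (U U' : set V) (f : V -> W) :
  U' `<=` U -> Ck k U f -> Ck k U' f.
Proof.
move=> sU; elim: k f => [|k IHk] f /=; first by move=> fU x /sU /fU.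
by move=> [dU DU]; split=> [x /sU /dU //|v]; exact/IHk/DU.
Qed.

Lemma Ck_pred V W k (U : set V) (f : V -> W) : Ck k.+1 U f -> Ck k U f.
Proof.
elim: k f => [|k IHk] f [dU DU].
  by move=> x Ux; exact/differentiable_continuous/dU.
by split=> // v; exact/IHk/DU.
Qed.

Section Curves.
Context {W : normedModType R}.
Variables (U : set R^o) (oU : open U).
Implicit Types (f g : R^o -> W) (a b : R^o -> R^o).

(** On an open set both differentiability and directional derivatives are
local, so the calculus rules below, which hold only on [U], can be iterated. *)
Lemma Ck_eq k f g :
  (forall t, U t -> f t = g t) -> Ck k U f -> Ck k U g.
Proof.
elim: k f g => [|k IHk] f g fg.
  move=> fU t Ut.
  have nfg : \forall s \near t, f s = g s.
    by apply: filterS (fg) _; exact: open_nbhs_nbhs.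
  rewrite /prop_for /continuous_at -(fg t Ut).
  by apply: cvg_trans (fU t Ut); exact: near_eq_cvg.
move=> [dU DU]; have nfg t : U t -> \forall s \near t, f s = g s.
  by move=> Ut; apply: filterS (fg) _; exact: open_nbhs_nbhs.
split=> [t Ut|v].
  apply/derivable1_diffP.
  by apply: (near_eq_derivable (nfg t Ut)); apply/derivable1_diffP/dU.
apply: IHk (DU v) => t Ut.
exact/near_eq_derive/nfg.
Qed.

Lemma Ck_add k f g : Ck k U f -> Ck k U g -> Ck k U (f \+ g).
Proof.
elim: k f g => [|k IHk] f g.
  by move=> fU gU t Ut; apply: continuousD; [exact: fU|exact: gU].
move=> [df Df] [dg Dg]; split=> [t Ut|v].
  by apply: differentiableD; [exact: df|exact: dg].
apply: (Ck_eq _ (IHk _ _ (Df v) (Dg v))) => t Ut /=.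
by rewrite deriveD//; apply: diff_derivable; [exact: df|exact: dg].
Qed.

Lemma Ck_scalel k a (w : W) : Ck k U a -> Ck k U (fun t => a t *: w).
Proof.
elim: k a => [|k IHk] a.
  by move=> aU t Ut; apply: continuousZr_tmp; exact: aU.
move=> [da Da]; split=> [t Ut|v]; first exact/differentiableZl/da.
apply: (Ck_eq _ (IHk _ (Da v))) => t Ut /=.
rewrite !deriveE ?diffZl//; [exact: da|exact/differentiableZl/da|exact: da].
Qed.

End Curves.

(** Leibniz: a derivative of the product is a sum of products to which the
induction hypothesis applies, once a C^(k+1) factor is seen as C^k. *)
Lemma Ck_mul (U : set R^o) (oU : open U) k (a b : R^o -> R^o) :
  Ck k U a -> Ck k U b -> Ck k U (fun t => a t * b t).
Proof.
elim: k a b => [|k IHk] a b.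
  by move=> aU bU t Ut; apply: continuousM; [exact: aU|exact: bU].
move=> Ca Cb; have [[da Da] [db Db]] := (Ca, Cb).
split=> [t Ut|v]; first by apply: differentiableM; [exact: da|exact: db].
have := Ck_add oU (IHk _ _ (Ck_pred Ca) (Db v)) (IHk _ _ (Ck_pred Cb) (Da v)).
apply: (Ck_eq oU) => t Ut /=.
by rewrite deriveM//; apply: diff_derivable; [exact: da|exact: db].
Qed.

(** The derivative - a' / a^2 of the inverse is a product involving the
inverse itself, which is only one order less smooth. *)
Lemma Ck_inv (U : set R^o) (oU : open U) k (a : R^o -> R^o) :
  (forall t, U t -> a t != 0) -> Ck k U a -> Ck k U (fun t => (a t)^-1).
Proof.
move=> a0; elim: k => [|k IHk].
  by move=> aU t Ut; apply: continuousV; [exact: a0|exact: aU].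
move=> Ca; have [da Da] := Ca.
split=> [t Ut|v]; first by apply: differentiableV; [exact: da|exact: a0].
have CV := IHk (Ck_pred Ca).
have CN := Ck_cst (W := R^o) k U (-1 : R^o).
have := Ck_mul oU (Ck_mul oU CN (Ck_mul oU CV CV)) (Da v).
apply: (Ck_eq oU) => t Ut /=.
rewrite deriveV ?a0//; last exact/diff_derivable/da.
by rewrite expr2 invfM mulN1r.
Qed.

Lemma smooth_nearD W (t : R^o) (f g : R^o -> W) :
  smooth_near t f -> smooth_near t g -> smooth_near t (f \+ g).
Proof.
move=> [U [oU Ut] CU] [U' [oU' U't] CU'].
exists (U `&` U') => [|k]; first by split; [exact: openI|].
apply: (Ck_add (openI oU oU')); first exact: Ck_sub (@subIsetl _ _ _) (CU k).
exact: Ck_sub (@subIsetr _ _ _) (CU' k).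
Qed.

Lemma smooth_nearM (t : R^o) (a b : R^o -> R^o) :
  smooth_near t a -> smooth_near t b -> smooth_near t (fun s => a s * b s).
Proof.
move=> [U [oU Ut] CU] [U' [oU' U't] CU'].
exists (U `&` U') => [|k]; first by split; [exact: openI|].
apply: (Ck_mul (openI oU oU')); first exact: Ck_sub (@subIsetl _ _ _) (CU k).
exact: Ck_sub (@subIsetr _ _ _) (CU' k).
Qed.

Lemma smooth_nearZl W (t : R^o) (a : R^o -> R^o) (w : W) :
  smooth_near t a -> smooth_near t (fun s => a s *: w).
Proof.
by move=> [U [oU Ut] CU]; exists U => // k; exact: (Ck_scalel oU w (CU k)).
Qed.

Lemma smooth_nearV (t : R^o) (a : R^o -> R^o) :
  a t != 0 -> smooth_near t a -> smooth_near t (fun s => (a s)^-1).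
Proof.
move=> at0 [U [oU Ut] CU].
have oU' : open (U `&` [set s | a s != 0]).
  move=> s [Us as0]; apply: filterI; first exact: open_nbhs_nbhs.
  exact: (@cvgr_neq0 R R^o _ (nbhs s) _ a (a s) (CU 0%N s Us) as0).
exists (U `&` [set s | a s != 0]); first by split.
move=> k; apply: (Ck_inv oU') => [s []//|].
exact: Ck_sub (@subIsetl _ _ _) (CU k).
Qed.

Lemma smooth_near_cst V W (x : V) (w : W) : smooth_near x (cst w).
Proof. by exists setT => [|k]; [split=> //; exact: openT|exact: Ck_cst]. Qed.

Lemma smooth_near_id V (x : V) : smooth_near x id.
Proof. by apply: (@smooth_near_linear _ _ idfun) => ?. Qed.

End SmoothCalculus.

(** * Linear maps restricted to a submanifold *)

Section TangentMaps.
Context {R : realType} {V W : normedModType R}.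
Implicit Types (M : set V) (L : {linear V -> W}).

Lemma is_derive_linear_comp L (c : R -> V) (t : R) (v : V) :
  continuous L -> is_derive t 1 c v -> is_derive t 1 (L \o c) (L v).
Proof.
move=> cL [dc <-].
have /derivable1_diffP dc' := dc.
have dLc : differentiable L (c t) by exact: linear_differentiable.
apply: DeriveDef; first exact/derivable1_diffP/differentiable_comp.
rewrite deriveE; last exact: differentiable_comp.
by rewrite diff_comp//= diff_lin// -deriveE.
Qed.

Lemma curves_at_is_derive M p v (c : R -> V) :
  curves_at M p v c -> is_derive (0 : R) 1 c v.
Proof.
move=> [sc _ _ <-]; rewrite derive1E; apply/derivableP/derivable1_diffP.
exact: (smooth_near_differentiable sc).
Qed.

(** The chain rule gives the same value for all curves, and tangency provides
at least one curve, so the default value is not taken. *)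
Lemma tdiff_linear M L p v :
  continuous L -> tangent_space M p v -> tdiff M L p v = L v.
Proof.
move=> cL [c0 Mc0]; rewrite /tdiff; case: xgetP => [w -> [c Mc <-]|no].
  rewrite derive1E; have := is_derive_linear_comp cL (curves_at_is_derive Mc).
  by move=> ?; rewrite derive_val.
by case: (no ((L \o c0)^`()%classic 0)); exists c0.
Qed.

Lemma smooth_map_linear M L : continuous L -> smooth_map M L.
Proof.
move=> cL p _; exists L; last by near=> q.
exact: smooth_near_linear.
Unshelve. all: by end_near. Qed.

(** The left inverse shows at once that the linear map has injective
differentials and that it is a homeomorphism onto its image. *)
Lemma linear_embedding M (N : set W) L (g : W -> V) :
  continuous L -> cancel L g -> continuous g -> L @` M `<=` N ->
  embedding M N L.
Proof.
move=> cL Lg cg LMN; split=> //; last first.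
  by exists g => [x _|]; [exact: Lg|exact: continuous_subspaceT].
split=> [|p v Mp Tv]; first exact: smooth_map_linear.
by rewrite tdiff_linear // => /(congr1 g); rewrite -[in RHS](linear0 L) !Lg.
Qed.

End TangentMaps.

(** * Tangent spaces of quadrics *)

Section Quadrics.
Context {R : realType}.

Definition diag_form {n : nat} (s : 'I_n -> R) (v w : 'rV[R]_n) : R :=
  \sum_i s i * (v 0 i * w 0 i).

Definition quadric {n : nat} (s : 'I_n -> R) (e : R) : set 'rV[R]_n :=
  [set x | diag_form s x x = e].

Lemma diag_formC n (s : 'I_n -> R) v w : diag_form s v w = diag_form s w v.
Proof. by apply: eq_bigr => i _; rewrite (mulrC (v 0 i)). Qed.

Lemma diag_form_comb n (s : 'I_n -> R) a b x w y :
  diag_form s (a *: x + b *: w) y = a * diag_form s x y + b * diag_form s w y.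
Proof.
rewrite /diag_form !mulr_sumr -big_split /=; apply: eq_bigr => i _.
by rewrite !mxE; ring.
Qed.

Lemma diag_formZl n (s : 'I_n -> R) a x y :
  diag_form s (a *: x) y = a * diag_form s x y.
Proof.
by have := diag_form_comb s a 0 x 0 y; rewrite scaler0 addr0 mul0r addr0.
Qed.

Lemma diag_formZr n (s : 'I_n -> R) a x y :
  diag_form s x (a *: y) = a * diag_form s x y.
Proof. by rewrite diag_formC diag_formZl diag_formC. Qed.

Lemma is_derive_coord n (f : R -> 'rV[R]_n.+1) (t : R) df i :
  is_derive t 1 f df -> is_derive t 1 (fun r => f r 0 i) (df 0 i).
Proof.
move=> [fd <-]; apply: DeriveDef; first by move/derivable_mxP: fd; apply.
by rewrite derive_mx // mxE.
Qed.

Lemma is_derive_diag_form n (s : 'I_n.+1 -> R) (f g : R -> 'rV[R]_n.+1)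
    (t : R) df dg :
  is_derive t 1 f df -> is_derive t 1 g dg ->
  is_derive t 1 (fun r => diag_form s (f r) (g r))
    (diag_form s df (g t) + diag_form s (f t) dg).
Proof.
move=> fd gd.
rewrite /diag_form -big_split /=.
rewrite (_ : (fun r => _) =
  \sum_i (s i *: ((fun r => f r 0 i) * (fun r => g r 0 i)))); last first.
  by apply/funext=> r; rewrite fct_sumE.
apply: is_derive_sum => i.
have fi := is_derive_coord i fd; have gi := is_derive_coord i gd.
apply: is_derive_eq.
rewrite /GRing.scale /=; ring.
Qed.

(** The derivative of the constant t |-> <f t, f t> is twice <f t, f' t>. *)
Lemma derive_on_quadric n (s : 'I_n.+1 -> R) e
    (f : R -> 'rV[R]_n.+1) (t : R) w :
  is_derive t 1 f w -> (\forall r \near t, quadric s e (f r)) ->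
  diag_form s (f t) w = 0.
Proof.
move=> fd fe.
have [_ D1] := is_derive_diag_form s fd fd.
have D0 : is_derive t 1 (fun r => diag_form s (f r) (f r)) 0.
  apply: near_eq_is_derive (is_derive_cst e t 1).
  by apply: filterS fe => r /= ->.
have := @derive_val _ _ _ _ _ _ _ D0; rewrite D1 diag_formC => /eqP.
by rewrite -mulr2n mulrn_eq0 => /eqP.
Qed.

(** The plane spanned by x and w cuts the quadric in a conic. The second point
of this conic on the line through - x with direction 2 x + t w is a rational
function of t, equal to x at t = 0, with velocity w there. *)
Lemma conic_curve n (s : 'I_n.+1 -> R) e x w :
  e != 0 -> quadric s e x -> diag_form s x w = 0 ->
  exists a b : R^o -> R^o,
    [/\ smooth_near (0 : R^o) a /\ smooth_near (0 : R^o) b,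
        a 0 = 1 /\ b 0 = 0, is_derive (0 : R) 1 a 0 /\ is_derive (0 : R) 1 b 1 &
        \forall t \near (0 : R), quadric s e (a t *: x + b t *: w)].
Proof.
move=> e0 Qx xw.
(* a x + b w = - x + r (2 x + t w) is on the quadric for r = 1 / (1 - k t^2). *)
pose k := - diag_form s w w / (4 * e).
pose q : R^o -> R^o := fun t => 1 + (- k) * (t * t).
have sq : smooth_near (0 : R^o) q.
  apply: (smooth_nearD (smooth_near_cst (0 : R^o) (1 : R^o))).
  apply: (smooth_nearM (smooth_near_cst (0 : R^o) (- k : R^o))).
  by apply: smooth_nearM; exact: smooth_near_id.
have q0 : q 0 = 1 by rewrite /q mul0r mulr0 addr0.
have dq : is_derive (0 : R) 1 (q : R -> R) 0.
  have D := is_deriveD (is_derive_cst (1 : R) (0 : R) 1)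
    (is_deriveZ (- k)
      (is_deriveM (is_derive_id (0 : R) 1) (is_derive_id (0 : R) 1))).
  rewrite scale0r addr0 scaler0 addr0 in D.
  exact: D.
have sr : smooth_near (0 : R^o) (fun t => (q t)^-1).
  by apply: smooth_nearV sq; rewrite q0 oner_neq0.
have dr : is_derive (0 : R) 1 (fun t => (q t)^-1 : R) 0.
  have q00 : q 0 != 0 by rewrite q0 oner_neq0.
  apply: DeriveDef; first exact: derivableV.
  by rewrite (deriveV q00) // derive_val scaler0.
exists (fun t => -1 + 2 * (q t)^-1), (fun t => t * (q t)^-1).
split.
- split; last exact: smooth_nearM (smooth_near_id _) sr.
  apply: (smooth_nearD (smooth_near_cst (0 : R^o) (-1 : R^o))).
  exact: (smooth_nearM (smooth_near_cst (0 : R^o) (2 : R^o))).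
- by rewrite q0 invr1 mulr1 mul0r; split=> //; ring.
- split.
    have D := is_deriveD (is_derive_cst (-1 : R) (0 : R) 1) (is_deriveZ 2 dr).
    by rewrite scaler0 addr0 in D.
  have D := is_deriveM (is_derive_id (0 : R) 1) dr.
  by rewrite scaler0 add0r q0 invr1 scale1r in D.
- have : \forall t \near (0 : R), q t != 0.
    have cq := differentiable_continuous (smooth_near_differentiable sq).
    apply: (@cvgr_neq0 R R^o _ (nbhs (0 : R^o)) _ q (q 0) cq).
    by rewrite q0 oner_neq0.
  apply: filterS => t qt; rewrite /quadric /= diag_form_comb.
  rewrite (diag_formC _ x) (diag_formC _ w) !diag_form_comb xw Qx.
  rewrite (diag_formC _ w) xw.
  have -> : diag_form s w w = - (k * (4 * e)).
    by rewrite /k divfK ?opprK// mulf_neq0 ?pnatr_eq0.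
  by rewrite /q in qt *; field.
Qed.

Section Product.
Variables (m n : nat) (s : 'I_m.+1 -> R) (s' : 'I_n.+1 -> R) (e e' : R).
Hypotheses (e0 : e != 0) (e'0 : e' != 0).
Let V := ('rV[R]_m.+1 * 'rV[R]_n.+1)%type.
Let M : set V := quadric s e `*` quadric s' e'.

(** For the curve with a prescribed velocity, writing it as a sum of fixed
vectors scaled by real functions reduces smoothness in the product to that of
these functions. *)
Lemma tangent_space_quadricM (p v : V) : M p ->
  tangent_space M p v <-> diag_form s p.1 v.1 = 0 /\ diag_form s' p.2 v.2 = 0.
Proof.
move=> [Mp1 Mp2]; split.
  move=> [c Mc]; have dc := curves_at_is_derive Mc.
  have [_ cM c0 _] := Mc.
  have d1 : is_derive (0 : R) 1 (fst \o c) v.1.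
    by apply: (is_derive_linear_comp (L := fst)) dc => y; exact: cvg_fst.
  have d2 : is_derive (0 : R) 1 (snd \o c) v.2.
    by apply: (is_derive_linear_comp (L := snd)) dc => y; exact: cvg_snd.
  have := derive_on_quadric (e := e) d1; have := derive_on_quadric (e := e') d2.
  by rewrite /= c0 => D2 D1; split; [apply: D1|apply: D2];
    apply: filterS cM => t [].
move=> [v1 v2].
have [a [b [[sa sb] [a0 b0] [da db] Qab]]] := conic_curve e0 Mp1 v1.
have [a' [b' [[sa' sb'] [a'0 b'0] [da' db'] Qab']]] := conic_curve e'0 Mp2 v2.
pose c : R^o -> V :=
  (fun t => a t *: ((p.1, 0) : V)) \+ (fun t => b t *: ((v.1, 0) : V))
  \+ (fun t => a' t *: ((0, p.2) : V)) \+ (fun t => b' t *: ((0, v.2) : V)).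
have cE t : c t = (a t *: p.1 + b t *: v.1, a' t *: p.2 + b' t *: v.2).
  by rewrite /c /=; congr pair; rewrite /= !scaler0 ?addr0 ?add0r.
exists c; split.
- by do !apply: smooth_nearD; exact: smooth_nearZl.
- by apply: filterS2 Qab Qab' => t Q1 Q2; rewrite cE.
- by rewrite cE a0 b0 a'0 b'0 !scale1r !scale0r !addr0; case: (p).
- rewrite derive1E.
  have dZ (f : R -> R) df (w : V) : is_derive (0 : R) 1 f df ->
      is_derive (0 : R) 1 (fun t => f t *: w) (df *: w).
    move=> [fd <-]; have/derivable1_diffP fd' := fd.
    apply: DeriveDef; first exact/derivable1_diffP/differentiableZl.
    rewrite !deriveE ?diffZl//; exact: differentiableZl.
  have D := is_deriveD (is_deriveD (is_deriveD (dZ _ _ (p.1, 0) da)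
    (dZ _ _ (v.1, 0) db)) (dZ _ _ (0, p.2) da')) (dZ _ _ (0, v.2) db').
  have -> : 'D_1 c 0 = _ := @derive_val _ _ _ _ _ _ _ D.
  rewrite !scale0r !scale1r add0r addr0.
  by case: (v) => ? ?; congr pair; rewrite /= ?addr0 ?add0r.
Qed.

End Product.

End Quadrics.

(** * Tubes around a totally geodesic subspace *)

Section Tube.
Context {R : realType} {k : nat}.
Local Notation V := ('rV[R]_k.+1 * 'rV[R]_2)%type.
Local Notation M := (hyperbolic_space k `*` circle : set V).
Implicit Types (a b : R) (p v : V).

(** The signature of [mink], which makes H^k one of the quadrics above. *)
Definition lorentz_sign {n} (i : 'I_n.+1) : R :=
  if i == ord_max then -1 else 1%R.
Definition dot2 (u v : 'rV[R]_2) : R := diag_form (fun=> 1) u v.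

Lemma mink_diag n (v w : 'rV[R]_n.+1) : mink v w = diag_form lorentz_sign v w.
Proof.
rewrite /mink /diag_form big_ord_recr /= /lorentz_sign eqxx mulN1r.
congr (_ - _).
apply: eq_bigr => i _; rewrite ifF ?mul1r.
  by congr (v 0 _ * w 0 _); exact: val_inj.
by apply/negbTE; rewrite -val_eqE /= ltn_eqF.
Qed.

Lemma minkC n (v w : 'rV[R]_n.+1) : mink v w = mink w v.
Proof. by rewrite !mink_diag diag_formC. Qed.

Lemma dot2C (u v : 'rV[R]_2) : dot2 u v = dot2 v u.
Proof. exact: diag_formC. Qed.

Lemma hyperbolic_quadric n :
  hyperbolic_space n = quadric lorentz_sign (-1) :> set 'rV[R]_n.+1.
Proof.
by apply/seteqP; split=> x; rewrite /hyperbolic_space /quadric /= mink_diag.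
Qed.

Lemma dot2E (u v : 'rV[R]_2) : dot2 u v = u 0 0 * v 0 0 + u 0 1 * v 0 1.
Proof.
rewrite /dot2 /diag_form !big_ord_recl big_ord0 !mul1r addr0.
by congr (_ + u 0 _ * v 0 _); exact: val_inj.
Qed.

Lemma circle_quadric : circle = quadric (fun=> 1) 1 :> set 'rV[R]_2.
Proof.
apply/seteqP; split=> u;
  by rewrite /circle /quadric /= -/(dot2 u u) dot2E !expr2.
Qed.

Lemma product_equations p : M p -> mink p.1 p.1 = -1 /\ dot2 p.2 p.2 = 1.
Proof. by rewrite circle_quadric => -[]. Qed.

Lemma tangent_space_product p v : M p ->
  tangent_space M p v <-> mink p.1 v.1 = 0 /\ dot2 p.2 v.2 = 0.
Proof.
rewrite hyperbolic_quadric circle_quadric mink_diag.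
by apply: tangent_space_quadricM; rewrite ?oppr_eq0 oner_neq0.
Qed.

(** The R^2 summand comes first, so that the timelike coordinate of x remains
the last one. *)
Definition tube a b (p : V) : 'rV[R]_(2 + k.+1) := row_mx (a *: p.2) (b *: p.1).

Lemma tube_is_linear a b : linear (tube a b).
Proof.
move=> c p q; rewrite /tube scale_row_mx add_row_mx /=.
by rewrite !scalerDr !scalerA (mulrC a c) (mulrC b c).
Qed.

HB.instance Definition _ a b :=
  GRing.isLinear.Build R V 'rV[R]_(2 + k.+1) *:%R (tube a b)
    (@tube_is_linear a b).

Lemma row_mx_continuous m n :
  continuous (fun p : 'rV[R]_m.+1 * 'rV[R]_n.+1 => row_mx p.1 p.2).
Proof.
move=> p A /nbhs_ballP[e /= e0 eA].
apply/nbhs_ballP; exists e => //= q [[_ pq1] [_ pq2]].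
apply: eA; split=> // i j.
by rewrite !mxE; case: splitP => l _; [exact: pq1|exact: pq2].
Qed.

Lemma pair_continuous (T U W : topologicalType) (f : T -> U) (g : T -> W) :
  continuous f -> continuous g -> continuous (fun x => (f x, g x)).
Proof. by move=> cf cg x; apply: cvg_pair; [exact: cf|exact: cg]. Qed.

Lemma tube_continuous a b : continuous (tube a b).
Proof.
have cab : continuous (fun p : V => (a *: p.2, b *: p.1)).
  apply: pair_continuous => p; apply: cvgZl_tmp.
    exact: cvg_snd.
  exact: cvg_fst.
move=> p; exact: (continuous_comp (cab p) (@row_mx_continuous 1 k _)).
Qed.

Lemma mink_row_mx (u u' : 'rV[R]_2) (x x' : 'rV[R]_k.+1) :
  mink (row_mx u x : 'rV[R]_k.+3) (row_mx u' x') = dot2 u u' + mink x x'.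
Proof.
rewrite !mink_diag /dot2 /diag_form [LHS](@big_split_ord _ _ _ 2 k.+1) /=.
congr (_ + _); apply: eq_bigr => i _.
  rewrite (row_mxEl u x 0 i) (row_mxEl u' x' 0 i) /lorentz_sign ifF //.
  by apply/negbTE; rewrite -val_eqE /= ltn_eqF //; case: i => -[|[]].
rewrite (row_mxEr u x 0 i) (row_mxEr u' x' 0 i) /lorentz_sign.
by rewrite -!val_eqE /=.
Qed.

Lemma mink_tube a b c d p q :
  mink (tube a b p) (tube c d q) = a * c * dot2 p.2 q.2 + b * d * mink p.1 q.1.
Proof.
by rewrite mink_row_mx !mink_diag /dot2 !(diag_formZl, diag_formZr); ring.
Qed.

Definition untube a b (y : 'rV[R]_(2 + k.+1)) : V :=
  (b^-1 *: @rsubmx R 1 2 k.+1 y, a^-1 *: @lsubmx R 1 2 k.+1 y).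

Lemma tubeK a b : a != 0 -> b != 0 -> cancel (tube a b) (untube a b).
Proof.
move=> a0 b0 [x u]; rewrite /tube /untube row_mxKl row_mxKr /= !scalerA.
by rewrite !mulVf // !scale1r.
Qed.

Lemma untube_continuous a b : continuous (untube a b).
Proof.
apply: pair_continuous => y.
  by apply: (continuous_comp (@continuous_rsubmx R 1 2 k.+1 y));
    exact: scaler_continuous.
by apply: (continuous_comp (@continuous_lsubmx R 1 2 k.+1 y));
  exact: scaler_continuous.
Qed.

Lemma tube_embedding a b : a != 0 -> b != 0 -> b ^+ 2 - a ^+ 2 = 1 ->
  embedding M (hyperbolic_space k.+2) (tube a b).
Proof.
move=> a0 b0 ab1.
apply: (linear_embedding (@tube_continuous a b) (tubeK a0 b0)).
  exact: untube_continuous.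
move=> _ [p /product_equations[Hp Cp] <-].
by rewrite /hyperbolic_space /= mink_tube Hp Cp mulr1 mulrN1 -!expr2 -opprB ab1.
Qed.

Lemma tube_unit_normal a b : b ^+ 2 - a ^+ 2 = 1 ->
  unit_normal M (tube a b) (tube b a).
Proof.
move=> ab1; split; first exact: (smooth_map_linear (@tube_continuous b a)).
move=> p Mp; have [Hp Cp] := product_equations Mp; split=> [||v Tv].
  by rewrite mink_tube Hp Cp mulr1 mulrN1 -!expr2.
  by rewrite mink_tube Hp Cp; ring.
rewrite (tdiff_linear (@tube_continuous a b) Tv) mink_tube.
by have [-> ->] := (tangent_space_product v Mp).1 Tv; rewrite !mulr0 addr0.
Qed.

Definition tube_shape a b (v : V) : V := (- (a / b) *: v.1, - (b / a) *: v.2).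

(** The Weingarten equation: each factor turns the coefficient of one summand
into that of the other, up to the sign. *)
Lemma tube_shapeE a b v : a != 0 -> b != 0 ->
  tube a b (tube_shape a b v) = - tube b a v.
Proof.
move=> a0 b0; rewrite /tube /tube_shape /= opp_row_mx !scalerA !mulrN.
by rewrite !(mulrC _ (_ / _)) !divfK // !scaleNr.
Qed.

(** The covariant derivative of the normal field is its ordinary derivative:
the latter is already orthogonal to the position vector. *)
Lemma tube_shape_operator a b p : a != 0 -> b != 0 -> M p ->
  shape_operator M (tube a b) (tube b a) p (tube_shape a b).
Proof.
move=> a0 b0 Mp v Tv.
have TvP := (tangent_space_product v Mp).1 Tv.
have TA : tangent_space M p (tube_shape a b v).
  apply/(tangent_space_product _ Mp); move: TvP.
  by rewrite !mink_diag /dot2 !diag_formZr => -[-> ->]; rewrite !mulr0.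
split=> //.
rewrite /covariant_deriv !(tdiff_linear (@tube_continuous _ _)) // mink_tube.
have [v1 v2] := TvP.
rewrite minkC v1 dot2C v2 !mulr0 addr0.
rewrite scale0r addr0; exact: tube_shapeE.
Qed.

(** The i-th coordinate vector, corrected along the last axis so as to become
orthogonal to x, for x in H^k, whose last coordinate is nonzero. *)
Definition orth_basis (x : 'rV[R]_k.+1) (i : 'I_k) : 'rV[R]_k.+1 :=
  delta_mx 0 (widen_ord (leqnSn k) i) +
    (x 0 (widen_ord (leqnSn k) i) / x 0 ord_max) *: delta_mx 0 ord_max.

Definition quarter_turn (u : 'rV[R]_2) : 'rV[R]_2 :=
  \row_j if j == 0 then - u 0 1 else u 0 0.

Definition tube_basis p (i : 'I_k.+1) : V :=
  if unlift ord0 i is Some j then (orth_basis p.1 j, 0)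
  else (0, quarter_turn p.2).

Lemma widen_ord_max (i : 'I_k) : (widen_ord (leqnSn k) i == ord_max) = false.
Proof. by apply/negbTE; rewrite -val_eqE /= ltn_eqF. Qed.

Lemma orth_basis_widen x (c : 'I_k -> R) (j : 'I_k) :
  (\sum_i c i *: orth_basis x i) 0 (widen_ord (leqnSn k) j) = c j.
Proof.
rewrite summxE (bigD1 j) //= big1 => [|i ij]; rewrite !mxE !eqxx /=.
  by rewrite widen_ord_max mulr0 !addr0 mulr1.
rewrite widen_ord_max mulr0 addr0 (_ : _ == _ = false) ?mulr0 //.
by apply/negbTE; rewrite -val_eqE /= eq_sym; exact: ij.
Qed.

Lemma orth_basis_max x (c : 'I_k -> R) :
  (\sum_i c i *: orth_basis x i) 0 ord_max =
  \sum_i c i * x 0 (widen_ord (leqnSn k) i) / x 0 ord_max.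
Proof.
rewrite summxE; apply: eq_bigr => i _; rewrite !mxE !eqxx /=.
by rewrite eq_sym widen_ord_max add0r mulr1 mulrA.
Qed.

(** A vector orthogonal to x is determined by its first k coordinates, which
are also its coordinates in the basis. *)
Lemma orth_basisP (x w : 'rV[R]_k.+1) : x 0 ord_max != 0 ->
  mink x w = 0 <->
  w = \sum_(i < k) w 0 (widen_ord (leqnSn k) i) *: orth_basis x i.
Proof.
move=> x0; rewrite /mink; split=> [/eqP|ew].
  rewrite subr_eq0 => /eqP xw; apply/rowP => j.
  have [->|jm] := eqVneq j ord_max.
    rewrite orth_basis_max -mulr_suml -[LHS](mulKf x0) mulrC -xw.
    by congr (_ / _); apply: eq_bigr => i _; rewrite mulrC.
  have jk : (j < k)%N.
    by rewrite ltn_neqAle -val_eqE in jm *; rewrite jm -ltnS ltn_ord.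
  have -> : j = widen_ord (leqnSn k) (Ordinal jk) by exact: val_inj.
  by rewrite orth_basis_widen.
rewrite [in X in _ - X]ew orth_basis_max mulr_sumr -sumrB big1 // => i _.
by rewrite mulrC [w 0 _ * _ / _ ]mulrC mulrA divff// ?mul1r subrr.
Qed.

Lemma hyperbolic_last_neq0 (x : 'rV[R]_k.+1) :
  mink x x = -1 -> x 0 ord_max != 0.
Proof.
rewrite /mink => xx; apply/eqP => x0; move: xx; rewrite x0 mulr0 subr0 => xx.
have : 0 <= -1 :> R.
  by rewrite -xx; apply: sumr_ge0 => i _; rewrite -expr2 sqr_ge0.
by rewrite oppr_ge0 ler10.
Qed.

(** As u is a unit vector, u and its quarter turn form an orthonormal basis of
the plane. *)
Lemma dot2_quarter_turn (u v : 'rV[R]_2) : dot2 u u = 1 ->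
  dot2 u v = 0 <-> v = dot2 v (quarter_turn u) *: quarter_turn u.
Proof.
rewrite !dot2E !mxE /= => u1; split=> [uv|->]; last by rewrite !mxE /=; ring.
apply/rowP => j; rewrite !mxE.
have [->|->] : j = 0 \/ j = 1.
  by case: j => -[|[|//]] ?; [left|right]; exact: val_inj.
  rewrite eqxx; transitivity (v 0 0 * (u 0 0 * u 0 0 + u 0 1 * u 0 1)
    - u 0 0 * (u 0 0 * v 0 0 + u 0 1 * v 0 1)); last by ring.
  by rewrite u1 uv mulr1 mulr0 subr0.
transitivity (v 0 1 * (u 0 0 * u 0 0 + u 0 1 * u 0 1)
  - u 0 1 * (u 0 0 * v 0 0 + u 0 1 * v 0 1)); last by rewrite /=; ring.
by rewrite u1 uv mulr1 mulr0 subr0.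
Qed.

Lemma sum_tube_basis p (c : 'I_k.+1 -> R) :
  \sum_i c i *: tube_basis p i =
  (\sum_j c (lift ord0 j) *: orth_basis p.1 j, c ord0 *: quarter_turn p.2).
Proof.
rewrite big_ord_recl /tube_basis unlift_none.
under eq_bigr do rewrite liftK.
rewrite (_ : \sum_(i < k) _ = (\sum_j c (lift ord0 j) *: orth_basis p.1 j, 0)).
  by congr pair; rewrite /= ?scaler0 ?add0r ?addr0.
elim/big_rec2: _ => // i y z _ ->.
by congr pair; rewrite /= ?scaler0 ?addr0.
Qed.

Lemma tube_basisP p : M p -> basis_of_set (tangent_space M p) (tube_basis p).
Proof.
move=> Mp; have [Hp Cp] := product_equations Mp.
have x0 := hyperbolic_last_neq0 Hp.
split=> [c|v].
  rewrite sum_tube_basis => -[c1 c2] i.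
  have [j ->|->] := unliftP ord0 i.
    have := orth_basis_widen p.1 (fun j => c (lift ord0 j)) j.
    by rewrite c1 mxE.
  have : dot2 (c ord0 *: quarter_turn p.2) (quarter_turn p.2) = 0.
    by rewrite c2 dot2E !mxE !mul0r addr0.
  rewrite dot2E !mxE /= => e; rewrite -[LHS]mulr1 -Cp dot2E -[RHS]e; ring.
split=> [/(tangent_space_product v Mp)[v1 v2]|[c ->]].
  exists (fun i => if unlift ord0 i is Some j
    then v.1 0 (widen_ord (leqnSn k) j) else dot2 v.2 (quarter_turn p.2)).
  rewrite sum_tube_basis unlift_none; under eq_bigr do rewrite liftK.
  rewrite -(orth_basisP v.1 x0).1 // -(dot2_quarter_turn v.2 Cp).1 //.
  by case: (v).
apply/(tangent_space_product _ Mp); rewrite sum_tube_basis /=; split.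
  by apply/(orth_basisP _ x0); apply: eq_bigr => i _; rewrite orth_basis_widen.
by apply/(dot2_quarter_turn _ Cp); move: Cp; rewrite !dot2E !mxE /= => Cp;
  congr (_ *: _); rewrite -[LHS]mulr1 -Cp; ring.
Qed.

(** The circle direction, listed first in the basis, has principal curvature
- b / a; the k directions of H^k have principal curvature - a / b. *)
Lemma tube_mean_curvature a b : a != 0 -> b != 0 -> b ^+ 2 - a ^+ 2 = 1 ->
  constant_mean_curvature (n := k.+1) M (tube a b)
    (- (b / a + k%:R * (a / b)) / k.+1%:R).
Proof.
move=> a0 b0 ab1; exists (tube b a); first exact: tube_unit_normal.
move=> p Mp.
exists (fun i : 'I_k.+1 => if i == ord0 then - (b / a) else - (a / b)).
  exists (tube_shape a b); first exact: tube_shape_operator.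
  exists (tube_basis p); first exact: tube_basisP.
  move=> i; rewrite /tube_shape /tube_basis.
  have [j ->|->] := unliftP ord0 i.
    by congr pair; rewrite /= ?scaler0.
  by congr pair; rewrite /= ?scaler0.
congr (_ / _); rewrite big_ord_recl eqxx /= sumr_const card_ord.
by rewrite opprD mulr_natl mulNrn.
Qed.

End Tube.

(** * Prescribing the mean curvature *)

(** z is the larger root of z^2 - n |H| z + (n - 1) = 0. The discriminant is
nonnegative as n |H| > n >= 2 sqrt (n - 1), and z > 1 as n |H| > 2. *)
Lemma radius_ratio (R : rcfType) (n : nat) (H : R) :
  (1 < n)%N -> H < -1 -> exists2 z : R, 1 < z &
    H = - (z + n.-1%:R * z^-1) / n%:R.
Proof.
case: n => // k k0 H1.
have k1 : 1 <= k%:R :> R by rewrite ler1n.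
pose h := - H * k.+1%:R; pose D := h ^+ 2 - 4 * k%:R.
have hk : k%:R + 1 < h.
  by rewrite /h mulrC -natr1 ltr_pMr; lra.
have D0 : 0 <= D.
  rewrite /D; have : (k%:R + 1) ^+ 2 <= h ^+ 2 by rewrite lerXn2r ?nnegrE; lra.
  have := sqr_ge0 (k%:R - 1 : R); rewrite !expr2; lra.
pose z := (h + Num.sqrt D) / 2.
have z1 : 1 < z by have := sqrtr_ge0 D; rewrite /z; lra.
exists z => //=.
have zz : z ^+ 2 - h * z + k%:R = 0.
  have -> : k%:R = (h ^+ 2 - Num.sqrt D ^+ 2) / 4.
    by rewrite sqr_sqrtr // /D; field.
  by rewrite /z; field.
have z0 : z != 0 by rewrite gt_eqF //; lra.
have n0 : k.+1%:R != 0 :> R by rewrite pnatr_eq0.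
have -> : z + k%:R * z^-1 = h.
  apply: (mulIf z0); rewrite mulrDl divfK //; move: zz; rewrite expr2; lra.
by rewrite /h; field.
Qed.

Theorem corollary3p3 (R : realType) (n : nat) (hn : (1 < n)%N) :
  exists2 H0 : R, H0 <= -1 &
  forall H : R, H < H0 ->
  exists2 phi : 'rV[R]_(n.-1).+1 * 'rV[R]_2 -> 'rV[R]_n.+2,
    embedding (hyperbolic_space n.-1 `*` circle) (hyperbolic_space n.+1) phi &
    constant_mean_curvature (hyperbolic_space n.-1 `*` circle) phi H.
Proof.
exists (-1) => // H H1.
have [z z1 ->] := radius_ratio hn H1.
case: n hn => // k hn /=.
have zz0 : 0 < z ^+ 2 - 1 by rewrite subr_gt0 expr_gt1 //; lra.
(* The only a > 0 for which b = z a satisfies b^2 - a^2 = 1. *)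
pose a := (Num.sqrt (z ^+ 2 - 1))^-1.
have a0 : a != 0 by rewrite invr_neq0 // gt_eqF // sqrtr_gt0.
have z0 : z != 0 by rewrite gt_eqF //; lra.
have b0 : z * a != 0 by rewrite mulf_neq0.
have ab1 : (z * a) ^+ 2 - a ^+ 2 = 1.
  rewrite exprMn -[X in _ - X]mul1r -mulrBl /a exprVn sqr_sqrtr ?ltW //.
  by rewrite divff // gt_eqF.
exists (tube a (z * a)); first exact: tube_embedding.
have := tube_mean_curvature (k := k) a0 b0 ab1.
have -> : a / (z * a) = z^-1 by rewrite invfM mulrCA divff ?mulr1.
by rewrite mulfK.
Qed.
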